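(* The calculus $\mathbf{L}^{\Lambda}_{\backslash,/}\wedge\mathbf{0}\mathbf{1}$ is strongly complete with respect to the class of product-free non-standard square R-models: for every set $\mathcal{H}$ of product-free sequents and every product-free sequent $\Pi\to B$, if $\Pi\to B$ is true in every product-free non-standard square R-model in which all sequents of $\mathcal{H}$ are true, then $\Pi\to B$ is derivable from $\mathcal{H}$ in $\mathbf{L}^{\Lambda}_{\backslash,/}\wedge\mathbf{0}\mathbf{1}$.
   Context: Product-free formulae are built from a countable set of propositional variables and the constants $\mathbf{0}$ and $\mathbf{1}$ using the binary connectives $\backslash$, $/$, $\wedge$. A sequent is $\Pi \to B$ with $B$ a formula and $\Pi$ a finite, possibly empty, sequence of formulae (empty sequence written $\Lambda$). The calculus $\mathbf{L}^{\Lambda}_{\backslash,/}\wedge\mathbf{0}\mathbf{1}$ has axioms $A \to A$, $\Gamma,\mathbf{0},\Delta \to C$, $\Lambda \to \mathbf{1}$ and rules (capital Greek letters denote possibly empty sequences): (Cut) from $\Pi \to A$ and $\Gamma, A, \Delta \to C$ infer $\Gamma,\Pi,\Delta\to C$; ($\backslash L$) from $\Pi\to A$ and $\Gamma,B,\Delta\to C$ infer $\Gamma,\Pi,A\backslash B,\Delta\to C$; ($\backslash R$) from $A,\Pi\to B$ infer $\Pi\to A\backslash B$; ($/ L$) from $\Pi\to A$ and $\Gamma,B,\Delta\to C$ infer $\Gamma,B/A,\Pi,\Delta\to C$; ($/R$) from $\Pi,A\to B$ infer $\Pi\to B/A$; ($\wedge L$) from $\Gamma,A,\Delta\to C$ infer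 both $\Gamma,A\wedge B,\Delta\to C$ and $\Gamma,B\wedge A,\Delta\to C$; ($\wedge R$) from $\Pi\to A$ and $\Pi\to B$ infer $\Pi\to A\wedge B$; ($\mathbf{1} L$) from $\Gamma,\Delta\to C$ infer $\Gamma,\mathbf{1},\Delta\to C$. A sequent is derivable from a set of sequents $\mathcal H$ if it is derivable when the sequents of $\mathcal H$ are added as extra axioms. For binary relations $R,S$ on a non-empty set $W$: $R\circ S=\{(x,z) \mid \exists y\,((x,y)\in R, (y,z)\in S)\}$; $R\backslash S=\{(y,z)\in W\times W \mid \forall x\,((x,y)\in R\Rightarrow (x,z)\in S)\}$; $S/R=\{(x,y)\in W\times W \mid \forall z\,((y,z)\in R\Rightarrow(x,z)\in S)\}$; $\delta=\{(x,x)\mid x\in W\}$. A product-free non-standard square R-model is a tuple $(W,\mathfrak{A},\mathbf{1}_{\mathfrak{A}},\mathbf{0}_{\mathfrak{A}},v)$ where $W$ is non-empty; $\mathfrak{A}$ is a family of binary relations on $W$ closed under $\backslash,/,\cap$ (not necessarily under $\circ$); $\mathbf{1}_{\mathfrak{A}}\in\mathfrak{A}$ satisfies $\mathbf{1}_{\mathfrak{A}}\circ R=R\circ\mathbf{1}_{\mathfrak{A}}=R$ for all $R\in\mathfrak{A}$; $\mathbf{0}_{\mathfrak{A}}\in\mathfrak{A}$ satisfies $\mathbf{0}_{\mathfrak{A}}\subseteq R$ for all $R\in\mathfrak{A}$; and $v$ maps every product-free formula to a member of $\mathfrak{A}$ with $v(A\backslash B)=v(A)\backslash v(B)$, $v(B/A)=v(B)/v(A)$,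 $v(A\wedge B)=v(A)\cap v(B)$, $v(\mathbf{1})=\mathbf{1}_{\mathfrak{A}}$, $v(\mathbf{0})=\mathbf{0}_{\mathfrak{A}}$. A sequent $A_1,\ldots,A_n\to B$ ($n\ge1$) is true in the model if $v(A_1)\circ\cdots\circ v(A_n)\subseteq v(B)$, and $\Lambda\to B$ is true if $\delta\subseteq v(B)$. *)

(* Defs.v *)
(* Binary relations on [W] are [set (W * W)], for which Leibniz equality is
   extensional. *)
From mathcomp Require Import all_boot.
From mathcomp Require Import boolp classical_sets.

Set Implicit Arguments.
Unset Strict Implicit.
Unset Printing Implicit Defensive.

Local Open Scope classical_set_scope.

(* [Under A B] is A \ B and [Over B A] is B / A. *)
Inductive formula : Type :=
| Var of nat
| Zero
| One
| Under of formula & formula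
| Over of formula & formula
| Meet of formula & formula.

Record sequent : Type := Sequent { antecedent : seq formula; succedent : formula }.

Notation "Pi ==>> B" := (Sequent Pi B) (at level 70, no associativity).

Inductive derivable (H : set sequent) : sequent -> Prop :=
| d_hyp s : H s -> derivable H s
| d_ax A : derivable H ([:: A] ==>> A)
| d_zeroL Gamma Delta C : derivable H (Gamma ++ Zero :: Delta ==>> C)
| d_oneR : derivable H ([::] ==>> One)
| d_cut Gamma Pi Delta A C :
    derivable H (Pi ==>> A) ->
    derivable H (Gamma ++ A :: Delta ==>> C) ->
    derivable H (Gamma ++ Pi ++ Delta ==>> C)
| d_underL Gamma Pi Delta A B C :
    derivable H (Pi ==>> A) ->
    derivable H (Gamma ++ B :: Delta ==>> C) ->
    derivable H (Gamma ++ Pi ++ Under A B :: Delta ==>> C)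
| d_underR Pi A B :
    derivable H (A :: Pi ==>> B) ->
    derivable H (Pi ==>> Under A B)
| d_overL Gamma Pi Delta A B C :
    derivable H (Pi ==>> A) ->
    derivable H (Gamma ++ B :: Delta ==>> C) ->
    derivable H (Gamma ++ Over B A :: Pi ++ Delta ==>> C)
| d_overR Pi A B :
    derivable H (rcons Pi A ==>> B) ->
    derivable H (Pi ==>> Over B A)
| d_meetL1 Gamma Delta A B C :
    derivable H (Gamma ++ A :: Delta ==>> C) ->
    derivable H (Gamma ++ Meet A B :: Delta ==>> C)
| d_meetL2 Gamma Delta A B C :
    derivable H (Gamma ++ A :: Delta ==>> C) ->
    derivable H (Gamma ++ Meet B A :: Delta ==>> C)
| d_meetR Pi A B :
    derivable H (Pi ==>> A) ->
    derivable H (Pi ==>> B) ->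
    derivable H (Pi ==>> Meet A B)
| d_oneL Gamma Delta C :
    derivable H (Gamma ++ Delta ==>> C) ->
    derivable H (Gamma ++ One :: Delta ==>> C).

(* The library's [\;] composes in the opposite order, so it is not used. *)
Definition rel_comp (W : Type) (R S : set (W * W)) : set (W * W) :=
  [set p | exists y, R (p.1, y) /\ S (y, p.2)].

(* R \ S *)
Definition rel_under (W : Type) (R S : set (W * W)) : set (W * W) :=
  [set p | forall x, R (x, p.1) -> S (x, p.2)].

(* S / R *)
Definition rel_over (W : Type) (S R : set (W * W)) : set (W * W) :=
  [set p | forall z, R (p.2, z) -> S (p.1, z)].

Record model : Type := Model {
  world : Type;
  world_nonempty : inhabited world;
  rel_family : set (set (world * world));
  rel_family_under : forall R S, rel_family R -> rel_family S -> rel_family (rel_under R S);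
  rel_family_over : forall R S, rel_family R -> rel_family S -> rel_family (rel_over S R);
  rel_family_cap : forall R S, rel_family R -> rel_family S -> rel_family (R `&` S);
  unit_rel : set (world * world);
  unit_family : rel_family unit_rel;
  unit_compl : forall R, rel_family R -> rel_comp unit_rel R = R;
  unit_compr : forall R, rel_family R -> rel_comp R unit_rel = R;
  zero_rel : set (world * world);
  zero_family : rel_family zero_rel;
  zero_sub : forall R, rel_family R -> zero_rel `<=` R;
  valu : formula -> set (world * world);
  valu_family : forall A, rel_family (valu A);
  valu_under : forall A B, valu (Under A B) = rel_under (valu A) (valu B);
  valu_over : forall A B, valu (Over B A) = rel_over (valu B) (valu A);
  valu_meet : forall A B, valu (Meet A B) = valu A `&` valu B;
  valu_one : valu One = unit_rel;
  valu_zero : valu Zero = zero_rel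
}.

Arguments rel_family : clear implicits.
Arguments unit_rel : clear implicits.
Arguments zero_rel : clear implicits.
Arguments valu : clear implicits.

(* v(A) o v(A_1) o ... o v(A_n), for Pi = A_1, ..., A_n. *)
Fixpoint comp_seq (W : Type) (v : formula -> set (W * W))
    (A : formula) (Pi : seq formula) : set (W * W) :=
  if Pi is A1 :: Pi' then rel_comp (v A) (comp_seq v A1 Pi') else v A.

Definition true_in (M : model) (s : sequent) : Prop :=
  match antecedent s with
  | [::] => diagonal `<=` valu M (succedent s)
  | A :: Pi => comp_seq (valu M) A Pi `<=` valu M (succedent s)
  end.

(* Main.v *)
(** Take the oriented tree in which every vertex has, for each formula [A], a
    fresh child reached by an outgoing edge labelled [A] and a fresh child
    reached by an incoming one; it plays the role of the Cayley graph of the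
    free group on the formulae.  A directed path between two vertices is unique
    if it exists, and [v(A)] relates [x] to [y] when the labels of the directed
    path from [x] to [y] form a sequence deriving [A].  The divisions are
    computed correctly because every [y] has two distinct predecessors, along
    [A] and along [A /\ A], both related to [y] by [v(A)]: if directed paths
    lead from both of them to [z], then these paths go through [y].  Dually for
    successors. *)

Require Import Defs.
From mathcomp Require Import all_boot.
From mathcomp Require Import boolp classical_sets.

Set Implicit Arguments.
Unset Strict Implicit.
Unset Printing Implicit Defensive.

Local Open Scope classical_set_scope.

Lemma cat_injl (T : Type) (s1 s2 y : seq T) : s1 ++ y = s2 ++ y -> s1 = s2.
Proof.
move=> E; have Es : size s1 = size s2.
  by have /eqP := congr1 size E; rewrite !size_cat eqn_add2r => /eqP.
by have := congr1 (take (size s1)) E; rewrite {2}Es !take_size_cat.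
Qed.

Lemma cat_cons_injm (T : Type) (s1 s2 y : seq T) (a b : T) :
  s1 ++ a :: y = s2 ++ b :: y -> a = b.
Proof.
by rewrite -!cat_rcons => /cat_injl/(congr1 rev); rewrite !rev_rcons => -[].
Qed.

(** This keeps apart the two children of a vertex labelled [A] and [Meet A A]. *)
Lemma Meet_neq (A : formula) : Meet A A <> A.
Proof. by elim: A => // A IHA B _ [EA /(etrans (esym EA)) E]; apply: IHA; rewrite {2}E. Qed.

(* A vertex is its path to the root, the root being [[::]]; the letter
   [(true, A)] (resp. [(false, A)]) on top of [w] is a child of [w] joined to it
   by an edge labelled [A] that leaves (resp. enters) [w]. *)
Notation vertex := (seq (bool * formula)).

(** A vertex is spelled from its own end towards the root, so a climb shows its labels in order and
    a descent shows them reversed. *)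
Definition in_chain (Gamma : seq formula) : vertex := map (pair false) Gamma.
Definition out_chain (Gamma : seq formula) : vertex := rev (map (pair true) Gamma).

(* A directed path in the tree first climbs to a common ancestor [u] along edges
   pointing to the root, then descends along edges pointing away from it. *)
Definition dpath (x : vertex) (Gamma : seq formula) (y : vertex) : Prop :=
  exists Gamma1 Gamma2 u,
    [/\ Gamma = Gamma1 ++ Gamma2, x = in_chain Gamma1 ++ u
      & y = out_chain Gamma2 ++ u].

Lemma out_chain_rcons (Gamma : seq formula) (A : formula) :
  out_chain (rcons Gamma A) = (true, A) :: out_chain Gamma.
Proof. by rewrite /out_chain map_rcons rev_rcons. Qed.

Lemma out_chain_cat (Gamma Delta : seq formula) :
  out_chain (Gamma ++ Delta) = out_chain Delta ++ out_chain Gamma.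
Proof. by rewrite /out_chain map_cat rev_cat. Qed.

Lemma dpath_nil (x : vertex) : dpath x [::] x.
Proof. by exists [::], [::], x. Qed.

Lemma dpath_out (x : vertex) (A : formula) : dpath x [:: A] ((true, A) :: x).
Proof. by exists [::], [:: A], x. Qed.

Lemma dpath_in (x : vertex) (A : formula) : dpath ((false, A) :: x) [:: A] x.
Proof. by exists [:: A], [::], x. Qed.

(** If the first path ended with a descent and the second began with a climb, the top letter of [y]
    would carry both flags. So one of the two is empty, and the joined path still climbs before it
    descends. *)
Lemma dpath_cat (x y z : vertex) (Gamma Delta : seq formula) :
  dpath x Gamma y -> dpath y Delta z -> dpath x (Gamma ++ Delta) z.
Proof.
move=> [G1] [G2] [u] [-> -> ->] [[|A D1]] [D2] [u'] [-> E ->].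
  exists G1, (G2 ++ D2), u; split=> //; first by rewrite -catA.
  by rewrite -[u']E out_chain_cat catA.
case/lastP: G2 E => [|G2 B]; last by rewrite out_chain_rcons.
move=> /= ->; exists (G1 ++ A :: D1), D2, u'; split=> //.
- by rewrite cats0 -catA.
- by rewrite /in_chain map_cat -catA.
Qed.

Lemma in_out_chain_inj (Gamma Gamma' Delta Delta' : seq formula) (u u' : vertex) :
  in_chain Gamma ++ u = in_chain Gamma' ++ u' ->
  out_chain Delta ++ u = out_chain Delta' ++ u' ->
  Gamma ++ Delta = Gamma' ++ Delta'.
Proof.
(* If one climb exceeded the other by a nonempty [D0], letters flagged [false] would occur in an
   out-chain. *)
have out_in D0 : forall D D' (v : vertex),
    out_chain D ++ v = out_chain D' ++ in_chain D0 ++ v -> D0 = [::] /\ D = D'.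
  move=> D D' v; rewrite catA => /cat_injl E; case: D0 E => [|A D0] E.
    by move: E; rewrite cats0 => /(can_inj revK)/inj_map -> // B C [].
  have := congr1 (all fst) E.
  by rewrite all_cat /= andbF all_rev all_map all_predT.
elim: Gamma Gamma' => [|A G IHG] [|A' G'] /=.
- by move=> -> /(@out_in [::]) [_ ->].
- by move=> -> /esym/(@out_in (A' :: G') _ _ u') [].
- by move=> <- /(@out_in (A :: G) _ _ u) [].
- by case=> -> Eu Ev; rewrite (IHG G').
Qed.

Lemma dpath_uniq (x y : vertex) (Gamma Delta : seq formula) :
  dpath x Gamma y -> dpath x Delta y -> Gamma = Delta.
Proof.
move=> [G1] [G2] [u] [-> -> ->] [D1] [D2] [u'] [-> E1 E2].
exact: in_out_chain_inj E1 E2.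
Qed.

(** A path that climbs must begin with the edge into [y]; one that only descends stays in the
    subtree of its start. *)
Lemma dpath_from_in (y z : vertex) (A : formula) (Gamma : seq formula) :
  dpath ((false, A) :: y) Gamma z ->
  (exists2 Delta, Gamma = A :: Delta & dpath y Delta z) \/
  exists w, z = w ++ (false, A) :: y.
Proof.
move=> [[|B G1]] [G2] [u] [-> /= E ->].
  by right; exists (out_chain G2); rewrite E.
by case: E => -> ->; left; exists (G1 ++ G2) => //; exists G1, G2, u.
Qed.

Lemma dpath_to_out (x y : vertex) (A : formula) (Gamma : seq formula) :
  dpath x Gamma ((true, A) :: y) ->
  (exists2 Delta, Gamma = rcons Delta A & dpath x Delta y) \/
  exists w, x = w ++ (true, A) :: y.
Proof.
move=> [G1] [G2] [u]; case/lastP: G2 => [|G2 B] [-> ->].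
  by move=> /= <-; right; exists (in_chain G1).
rewrite out_chain_rcons /= => -[-> ->]; left; exists (G1 ++ G2).
  by rewrite rcons_cat.
by exists G1, G2, u.
Qed.

Section CanonicalModel.

Variable H : set sequent.

Definition canonical_valu (A : formula) : set (vertex * vertex) :=
  [set p | exists2 Gamma, dpath p.1 Gamma p.2 & derivable H (Gamma ==>> A)].

Lemma derivable_cut_all (Gamma : seq formula) (A C : formula) :
  derivable H (Gamma ==>> A) -> derivable H ([:: A] ==>> C) ->
  derivable H (Gamma ==>> C).
Proof. by move=> dA dC; have := @d_cut H [::] Gamma [::] A C dA dC; rewrite cats0. Qed.

Lemma derivable_MeetL (A : formula) : derivable H ([:: Meet A A] ==>> A).
Proof. exact: (@d_meetL1 H [::] [::] A A A (d_ax H A)). Qed.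

Lemma derivable_underE (Gamma Delta : seq formula) (A B : formula) :
  derivable H (Gamma ==>> A) -> derivable H (Delta ==>> Under A B) ->
  derivable H (Gamma ++ Delta ==>> B).
Proof.
move=> dA dAB; rewrite -[Delta]cats0.
apply: d_cut dAB _.
exact: (@d_underL H [::] Gamma [::] A B B dA (d_ax H B)).
Qed.

Lemma derivable_overE (Gamma Delta : seq formula) (A B : formula) :
  derivable H (Gamma ==>> Over B A) -> derivable H (Delta ==>> A) ->
  derivable H (Gamma ++ Delta ==>> B).
Proof.
move=> dBA dA; apply: (@d_cut H [::] Gamma Delta _ _ dBA).
by have := @d_overL H [::] Delta [::] A B B dA (d_ax H B); rewrite /= cats0.
Qed.

Lemma canonical_valu_under (A B : formula) :
  canonical_valu (Under A B) = rel_under (canonical_valu A) (canonical_valu B).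
Proof.
apply/seteqP; split=> -[y z] /=.
  move=> [D pyz dD] x [G pxy dG]; exists (G ++ D); first exact: dpath_cat pxy pyz.
  exact: derivable_underE dG dD.
move=> Hyz.
have [G p1 dG] : canonical_valu B ((false, A) :: y, z).
  by apply: Hyz; exists [:: A]; [exact: dpath_in | exact: d_ax].
have [G' p2 dG'] : canonical_valu B ((false, Meet A A) :: y, z).
  by apply: Hyz; exists [:: Meet A A]; [exact: dpath_in | exact: derivable_MeetL].
case/dpath_from_in: p1 => [[D EG pyz]|[w Ez]].
  by exists D => //; apply: d_underR; rewrite -EG.
case/dpath_from_in: p2 => [[D EG' pyz]|[w' Ez']].
  exists D => //; apply: d_underR; rewrite -cat1s.
  (* The label [Meet A A] is traded for [A], which derives it. *)
  apply: (@d_cut H [::] [:: A] D (Meet A A)); last by rewrite -EG'.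
  by apply: d_meetR; exact: d_ax.
(* Otherwise [z] would lie below two distinct siblings. *)
by have := cat_cons_injm (etrans (esym Ez') Ez) => -[] /Meet_neq.
Qed.

Lemma canonical_valu_over (A B : formula) :
  canonical_valu (Over B A) = rel_over (canonical_valu B) (canonical_valu A).
Proof.
apply/seteqP; split=> -[x y] /=.
  move=> [G pxy dG] z [D pyz dD]; exists (G ++ D); first exact: dpath_cat pxy pyz.
  exact: derivable_overE dG dD.
move=> Hxy.
have [G p1 dG] : canonical_valu B (x, (true, A) :: y).
  by apply: Hxy; exists [:: A]; [exact: dpath_out | exact: d_ax].
have [G' p2 dG'] : canonical_valu B (x, (true, Meet A A) :: y).
  by apply: Hxy; exists [:: Meet A A]; [exact: dpath_out | exact: derivable_MeetL].
case/dpath_to_out: p1 => [[D EG pxy]|[w Ex]].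
  by exists D => //; apply: d_overR; rewrite -EG.
case/dpath_to_out: p2 => [[D EG' pxy]|[w' Ex']].
  exists D => //; apply: d_overR; rewrite -cats1.
  apply: (@d_cut H D [:: A] [::] (Meet A A)); last by rewrite cats1 -EG'.
  by apply: d_meetR; exact: d_ax.
by have := cat_cons_injm (etrans (esym Ex') Ex) => -[] /Meet_neq.
Qed.

Lemma canonical_valu_meet (A B : formula) :
  canonical_valu (Meet A B) = canonical_valu A `&` canonical_valu B.
Proof.
apply/seteqP; split=> -[x y] /=.
  move=> [G p dG]; split; exists G => //; apply: derivable_cut_all dG _.
    exact: (@d_meetL1 H [::] [::] A B A (d_ax H A)).
  exact: (@d_meetL2 H [::] [::] B A B (d_ax H B)).
move=> [[G p dG] [D q dD]]; exists G => //; apply: d_meetR => //.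
(* [d_meetR] needs one antecedent for both premises; uniqueness of paths supplies it. *)
by rewrite (dpath_uniq p q).
Qed.

Lemma canonical_unit_compl (A : formula) :
  rel_comp (canonical_valu One) (canonical_valu A) = canonical_valu A.
Proof.
apply/seteqP; split=> -[x z] /=.
  move=> [y [[G p dG] [D q dD]]]; exists (G ++ D); first exact: dpath_cat p q.
  exact: (@d_cut H [::] G D One A dG (@d_oneL H [::] D A dD)).
move=> [G p dG]; exists x; split; last by exists G.
by exists [::]; [exact: dpath_nil | exact: d_oneR].
Qed.

Lemma canonical_unit_compr (A : formula) :
  rel_comp (canonical_valu A) (canonical_valu One) = canonical_valu A.
Proof.
apply/seteqP; split=> -[x z] /=.
  move=> [y [[G p dG] [D q dD]]]; exists (G ++ D); first exact: dpath_cat p q.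
  have := @d_cut H G D [::] One A dD; rewrite cats0; apply.
  by apply: d_oneL; rewrite cats0.
move=> [G p dG]; exists z; split; first by exists G.
by exists [::]; [exact: dpath_nil | exact: d_oneR].
Qed.

Lemma canonical_zero_sub (A : formula) : canonical_valu Zero `<=` canonical_valu A.
Proof.
move=> -[x y] [G p dG]; exists G => //; apply: derivable_cut_all dG _.
exact: (@d_zeroL H [::] [::] A).
Qed.

(** With only the values of formulae in the family, closure and the unit and zero laws reduce to the
    lemmas above. *)
Definition canonical_model : model.
Proof.
refine (@Model vertex (inhabits [::]) (range canonical_valu) _ _ _
  (canonical_valu One) _ _ _ (canonical_valu Zero) _ _ canonical_valu _
  canonical_valu_under canonical_valu_over canonical_valu_meet erefl erefl).
- by move=> _ _ [A _ <-] [B _ <-]; exists (Under A B); rewrite ?canonical_valu_under.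
- by move=> _ _ [A _ <-] [B _ <-]; exists (Over B A); rewrite ?canonical_valu_over.
- by move=> _ _ [A _ <-] [B _ <-]; exists (Meet A B); rewrite ?canonical_valu_meet.
- by exists One.
- by move=> _ [A _ <-]; exact: canonical_unit_compl.
- by move=> _ [A _ <-]; exact: canonical_unit_compr.
- by exists Zero.
- by move=> _ [A _ <-]; exact: canonical_zero_sub.
- by move=> A; exists A.
Defined.

(** Without a product, no single formula stands for [A :: Pi], so the path labels are characterised
    by what may replace [A :: Pi] at the end of an antecedent. The context [Gamma0] absorbs the
    labels already substituted during the induction. *)
Lemma comp_seq_canonical (A : formula) (Pi : seq formula) (x y : vertex) :
  comp_seq canonical_valu A Pi (x, y) ->
  exists2 Gamma, dpath x Gamma y &
    forall Gamma0 C, derivable H (Gamma0 ++ A :: Pi ==>> C) ->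
      derivable H (Gamma0 ++ Gamma ==>> C).
Proof.
elim: Pi A x => [|A' Pi IHPi] A x /=.
  move=> [G p dG]; exists G => // G0 C dC.
  by have := @d_cut H G0 G [::] A C dG dC; rewrite cats0.
move=> [z [[G p dG] /IHPi [D q dD]]]; exists (G ++ D); first exact: dpath_cat p q.
by move=> G0 C /(@d_cut H G0 G _ A C dG); rewrite !catA => /dD.
Qed.

Lemma comp_seq_out_chain (A : formula) (Pi : seq formula) (x : vertex) :
  comp_seq canonical_valu A Pi (x, out_chain (A :: Pi) ++ x).
Proof.
elim: Pi A x => [|A' Pi IHPi] A x /=.
  by exists [:: A]; [exact: dpath_out | exact: d_ax].
exists ((true, A) :: x); split.
  by exists [:: A]; [exact: dpath_out | exact: d_ax].
by rewrite (out_chain_cat [:: A]) -catA; exact: IHPi.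
Qed.

Lemma true_in_canonical (s : sequent) : true_in canonical_model s <-> derivable H s.
Proof.
case: s => -[|A Pi] B; rewrite /true_in /=; split.
(* The only path from the root to itself is empty. *)
- move=> /(_ ([::], [::]) erefl) [G p].
  by rewrite (dpath_uniq p (dpath_nil [::])).
- by move=> dB [x y]; rewrite /diagonal /= => ->; exists [::]; first exact: dpath_nil.
(* Truth is tested on the descent from the root labelled [A :: Pi]; by uniqueness, the sequence
   deriving [B] is [A :: Pi] itself. *)
- move=> /(_ _ (comp_seq_out_chain A Pi [::])) [G p].
  have q : dpath [::] (A :: Pi) (out_chain (A :: Pi) ++ [::]).
    by exists [::], (A :: Pi), [::].
  by rewrite (dpath_uniq p q).
- by move=> dB [x y] /comp_seq_canonical [G p /(_ [::] B dB)]; exists G.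
Qed.

End CanonicalModel.

Theorem theorem7p4 (H : set sequent) (Pi : seq formula) (B : formula) :
  (forall M : model,
     (forall s : sequent, H s -> true_in M s) -> true_in M (Sequent Pi B)) ->
  derivable H (Sequent Pi B).
Proof.
move=> HM; apply/true_in_canonical/HM => s Hs.
by apply/true_in_canonical; exact: d_hyp.
Qed.
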